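(* Let $r\ge1$, $\alpha>-1$, and let $c_1,\dots,c_r>0$ with $c_i\ne c_j$ whenever $i\ne j$. For $\vec n\in\mathbb{N}^r$ let $L_{\vec n}$ be the multiple Laguerre polynomial of the second kind, i.e. the monic polynomial of degree $|\vec n|$ satisfying $$\int_0^\infty x^kL_{\vec n}(x)\,x^{\alpha}e^{-c_jx}\,dx=0,\qquad k=0,1,\dots,n_j-1,\quad 1\le j\le r.$$ Then the coefficients in the nearest neighbor recurrence relations $$xL_{\vec n}(x)=L_{\vec n+\vec e_k}(x)+b_{\vec n,k}L_{\vec n}(x)+\sum_{j=1}^ra_{\vec n,j}L_{\vec n-\vec e_j}(x),\qquad 1\le k\le r,$$ are given, for all $\vec n\in\mathbb{N}^r$, by $$a_{\vec n,j}=\frac{(|\vec n|+\alpha)\,n_j}{c_j^2},\qquad 1\le j\le r,$$ $$b_{\vec n,k}=\frac{|\vec n|+\alpha+1}{c_k}+\sum_{j=1}^r\frac{n_j}{c_j},\qquad 1\le k\le r.$$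
   Context: $\mathbb{N}=\{0,1,2,\dots\}$, $|\vec n|=n_1+\cdots+n_r$, and $\vec e_j$ is the $j$-th standard unit vector in $\mathbb{N}^r$. Under the stated conditions all multi-indices are normal, i.e. $L_{\vec n}$ exists and is unique for every $\vec n$. The coefficients $a_{\vec n,j}$ do not depend on $k$; when $n_j=0$ one has $a_{\vec n,j}=0$ and the term with $L_{\vec n-\vec e_j}$ is absent. *)

(* Defs.v *)
From HB Require Import structures.
From mathcomp Require Import all_boot all_order all_algebra.
From mathcomp Require Import all_classical all_reals all_analysis.

Set Implicit Arguments.
Unset Strict Implicit.
Unset Printing Implicit Defensive.

Import Order.TTheory GRing.Theory Num.Theory.

Local Open Scope classical_set_scope.
Local Open Scope ring_scope.

Notation multiindex r := {ffun 'I_r -> nat}.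

Definition mi_size (r : nat) (n : multiindex r) : nat := (\sum_(j < r) n j)%N.

Definition mi_succ (r : nat) (n : multiindex r) (k : 'I_r) : multiindex r :=
  [ffun i => (n i + (i == k))%N].

(* n - e_j; the subtraction truncates, so this is meaningful only when
   0 < n j. *)
Definition mi_pred (r : nat) (n : multiindex r) (j : 'I_r) : multiindex r :=
  [ffun i => (n i - (i == j))%N].

(* The integrand is Lebesgue integrable on ]0, +oo[ as soon as -1 < alpha and
   0 < c j, so the integral never takes a conventional value there. *)
Definition is_multiple_laguerre2 (R : realType) (r : nat) (alpha : R)
    (c : 'I_r -> R) (n : multiindex r) (P : {poly R}) : Prop :=
  [/\ P \is monic,
      size P = (mi_size n).+1 &
      forall (j : 'I_r) (k : nat), (k < n j)%N ->
        (\int[@lebesgue_measure R]_(x in `]0%R, +oo[)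
           (x ^+ k * P.[x] * (x `^ alpha) * expR (- (c j * x)))%:E = 0)%E].

(* The term in L (n - e_j) is absent when n j = 0; the coefficient a n j, which
   would otherwise be unconstrained, is then 0 by convention. *)
Definition nearest_neighbor_recurrence (R : realType) (r : nat)
    (L : multiindex r -> {poly R})
    (a b : multiindex r -> 'I_r -> R) : Prop :=
  (forall (n : multiindex r) (j : 'I_r), n j = 0%N -> a n j = 0) /\
  (forall (n : multiindex r) (k : 'I_r),
     'X * L n = L (mi_succ n k) + b n k *: L n
                + \sum_(j < r | (0 < n j)%N) a n j *: L (mi_pred n j)).

(* Main.v *)
(* Let ell_j be the moment functional of x^alpha e^{-c_j x} on ]0, +oo[.
   Integration by parts (the only analytic input, together with positivity and
   finiteness of the moments) says ell_j (x p' + (alpha + 1 - c_j x) p) = 0.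

   If P is orthogonal for the index n and n_j > 0, then ell_j P = 0, so
   P x^alpha e^{-c_j x} is the derivative of Q x^{alpha+1} e^{-c_j x} for some
   polynomial Q of degree one less (Rodrigues); since the c_i are distinct, Q is
   orthogonal for n - e_j and the exponent alpha + 1. Induction on |n|, with
   alpha varying, yields
   - normality: an orthogonal P of degree < |n| vanishes;
   - the subleading coefficient of L_n, -(|n| + alpha) sum_j n_j / c_j;
   - ell_j (x^{n_j} L_n) = n_j! / c_j^{n_j}
       * prod_{i <> j} (1 - c_j / c_i)^{n_i} * ell_j (x^{|n|}) <> 0.
   The second item gives b_{n,k} as a difference of subleading coefficients, the
   third gives a_{n,j} as a quotient of moments. Conversely, with these values
   the defect of the recurrence has degree < |n| and is orthogonal for n, hence
   is zero by normality. *)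
Require Import Defs.
From HB Require Import structures.
From mathcomp Require Import all_boot all_order all_algebra.
From mathcomp Require Import all_classical all_reals all_analysis.
From mathcomp Require Import measurable_realfun.
From mathcomp Require Import ring lra zify.

Import Order.TTheory GRing.Theory Num.Theory.
Import numFieldNormedType.Exports.

Local Open Scope classical_set_scope.
Local Open Scope ring_scope.

Set Implicit Arguments.
Unset Strict Implicit.

(** * Arithmetic of multi-indices *)

Lemma mi_size_succ r (n : multiindex r) k :
  mi_size (mi_succ n k) = (mi_size n).+1.
Proof.
rewrite /mi_size; under eq_bigr do rewrite ffunE.
rewrite big_split/= -addn1; congr addn.
by rewrite (bigD1 k)//= eqxx big1// => i /negPf ->.
Qed.

Lemma mi_predK r (n : multiindex r) k :
  (0 < n k)%N -> mi_succ (mi_pred n k) k = n.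
Proof.
by move=> nk; apply/ffunP => i; rewrite !ffunE subnK//; case: eqVneq => // ->.
Qed.

Lemma mi_size_pred r (n : multiindex r) k :
  (0 < n k)%N -> mi_size n = (mi_size (mi_pred n k)).+1.
Proof. by move=> nk; rewrite -(mi_size_succ _ k) mi_predK. Qed.

Lemma mi_size_gt0P r (n : multiindex r) :
  reflect (exists k, (0 < n k)%N) (0 < mi_size n)%N.
Proof.
apply: (iffP idP) => [|[k nk]]; last by rewrite (mi_size_pred nk).
rewrite lt0n sum_nat_eq0 negb_forall => /existsP[k]; rewrite -lt0n => nk.
by exists k.
Qed.

Lemma mi_pred_other r (n : multiindex r) j i : i != j -> mi_pred n j i = n i.
Proof. by move=> /negPf ij; rewrite ffunE ij subn0. Qed.

Lemma mi_pred_same r (n : multiindex r) j : mi_pred n j j = (n j).-1.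
Proof. by rewrite ffunE eqxx subn1. Qed.

(** * Abstract moment functionals: the raising operator and the Rodrigues descent *)

Section algebra.
Context (R : realType) (r : nat) (al : R) (c : 'I_r -> R).
Context (ell : 'I_r -> {scalar {poly R}}).
Hypothesis c_neq0 : forall j, c j != 0.
Hypothesis c_neq : forall i j, i != j -> c i != c j.
Hypothesis ell_ibp : forall j (p : {poly R}),
  ell j ('X * p^`()) = - (al + 1) * ell j p + c j * ell j ('X * p).
Hypothesis ell_Xn : forall j m, ell j 'X^m != 0.

(* x^{-b} e^{c_j x} times the derivative of x^{b+1} e^{-c_j x} Q, where
   b = al + s. *)
Definition raise j s (Q : {poly R}) : {poly R} :=
  'X * Q^`() + (al + s%:R + 1) *: Q - c j *: ('X * Q).

Lemma raiseZ j s a Q : raise j s (a *: Q) = a *: raise j s Q.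
Proof.
by rewrite /raise derivZ -!scalerAr scalerBr scalerDr !scalerA ![_ * a]mulrC.
Qed.

Lemma raise0 j s : raise j s 0 = 0.
Proof. by rewrite /raise deriv0 !(mulr0, scaler0) subr0 addr0. Qed.

Lemma raiseD j s P Q : raise j s (P + Q) = raise j s P + raise j s Q.
Proof. by rewrite /raise derivD -!mul_polyC; ring. Qed.

(** This is [ell_ibp] at ['X^(s + k) * Q]. For [i = j] only the [k] term remains; for [i != j] the
    factor [c i - c j] is invertible. *)
Lemma ell_raise i j s k Q : ell i ('X^(s + k) * raise j s Q) =
  (c i - c j) * ell i ('X^(s.+1 + k) * Q) - k%:R * ell i ('X^(s + k) * Q).
Proof.
have := ell_ibp i ('X^(s + k) * Q).
have -> : 'X * ('X^(s + k) * Q)^`() =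
    'X^(s + k) * ('X * Q^`()) + (s + k)%:R *: ('X^(s + k) * Q).
  rewrite derivM derivXn; case: (s + k)%N => [|m] /=.
    by rewrite expr0 mulr0n mul0r scale0r; ring.
  by rewrite -mul_polyC polyC_natr -mulr_natl exprS; ring.
have -> : 'X^(s.+1 + k) * Q = 'X * ('X^(s + k) * Q)
  by rewrite addSn exprS mulrA.
rewrite (linearD (ell i)) (scalarZ (ell i))/= /raise mulrBr mulrDr -!scalerAr.
rewrite (linearB (ell i)) (linearD (ell i)) !(scalarZ (ell i))/= natrD.
rewrite ['X^(s + k) * ('X * Q)]mulrCA.
set A := ell i _; set B := ell i _; set C := ell i _ => H.
have -> : A = - (al + 1) * B + c i * C - (s%:R + k%:R) * B by rewrite -H addrK.
ring.
Qed.

(* The shift s replaces the exponent al of the weight by al + s. *)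
Definition orth s (n : multiindex r) (P : {poly R}) : Prop :=
  forall j k, (k < n j)%N -> ell j ('X^(s + k) * P) = 0.

(** The image of [raise j s] has codimension at most one: [raise j s 'X^k] has leading term
    [- c j *: 'X^(k.+1)], so powers reduce, one degree at a time, to constants. *)
Lemma raise_modC j s P : exists Q t, P = raise j s Q + t%:P.
Proof.
rewrite -[P]coefK poly_def;
elim/big_ind: _ => [|_ _ [Q [t ->]] [Q' [t' ->]]|k _].
- by exists 0, 0; rewrite raise0 polyC0 addr0.
- by exists (Q + Q'), (t + t'); rewrite raiseD polyCD addrACA.
have [Q [t ->]] : exists Q t, 'X^k = raise j s Q + t%:P.
  elim: {P k}(val k) => [|k [Q [t E]]].
    by exists 0, 1; rewrite raise0 add0r.
  have Er : raise j s ('X^k) =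
      (k%:R + al + s%:R + 1) *: 'X^k - c j *: 'X^(k.+1).
    rewrite /raise derivXn -exprS; congr (_ - _); case: k E => [|k] _ /=.
      by rewrite mulr0 !add0r.
    by rewrite mulrnAr -exprS -scaler_nat -scalerDl !addrA.
  set u := k%:R + _ + _ + _ in Er.
  (* These come from solving [Er] for ['X^(k.+1)] and inserting the decomposition [E] of ['X^k]. *)
  exists (- (c j)^-1 *: ('X^k) + (u / c j) *: Q), (u / c j * t).
  rewrite raiseD !raiseZ Er -addrA polyCM mul_polyC -scalerDr -E.
  rewrite scalerBr !scalerA !mulNr mulVf// scaleN1r opprK scaleNr [u / _]mulrC.
  by rewrite addrC addrA subrr add0r.
exists (P`_k *: Q), (P`_k * t).
by rewrite scalerDr raiseZ polyCM mul_polyC.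
Qed.

(** The Rodrigues step: only a constant separates [P] from the image of [raise j s]. The condition
    [k = 0] at [j] kills it, because [ell j 'X^s] is nonzero, and [ell_raise] transfers the other
    conditions to [Q]. *)
Lemma orth_descent s (n : multiindex r) P j : (0 < n j)%N -> orth s n P ->
  exists2 Q, P = raise j s Q & orth s.+1 (mi_pred n j) Q.
Proof.
move=> nj oP; have [Q [t EP]] := raise_modC j s P.
have t0 : t = 0.
  have := oP j 0%N nj; rewrite EP mulrDr linearD/= ell_raise subrr !mul0r.
  rewrite subrr add0r addn0 mulrC mul_polyC linearZ/= => /eqP.
  by rewrite mulf_eq0 (negPf (ell_Xn _ _)) orbF => /eqP.
rewrite t0 polyC0 addr0 in EP.
exists Q => // i k; have [->|ij] := eqVneq i j.
  rewrite mi_pred_same => kn.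
  (* Only the term with factor [k.+1] survives, so condition [k.+1] on [P] becomes condition [k] on
     [Q]: one condition at [j] is used up. *)
  have := oP j k.+1; rewrite -ltn_predRL kn EP => /(_ isT) /eqP.
  rewrite ell_raise subrr mul0r sub0r oppr_eq0 mulf_eq0 pnatr_eq0/= addnS -addSn.
  by move=> /eqP.
(* Away from [j] all conditions carry over: the second term of [ell_raise] is zero by induction, and
   [c i - c j] cancels. *)
rewrite mi_pred_other//; elim: k => [|k IH] kn.
  have := oP i 0%N kn; rewrite EP ell_raise mul0r subr0 => /eqP.
  by rewrite mulf_eq0 subr_eq0 (negPf (c_neq ij)) => /eqP.
have := oP i k.+1 kn; rewrite EP ell_raise -(addSnnS s) IH; last exact: ltnW.
rewrite mulr0 subr0 => /eqP.
by rewrite mulf_eq0 subr_eq0 (negPf (c_neq ij)) => /eqP.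
Qed.

Lemma coef_raise j s Q k : (raise j s Q)`_k =
  (k%:R + al + s%:R + 1) * Q`_k - c j * ('X * Q)`_k.
Proof.
rewrite /raise coefB coefD !coefZ !coefXM coef_deriv.
by case: k => [|k] /=; [rewrite mulr0n|rewrite -mulr_natl]; ring.
Qed.

Lemma coef_raise_size j s Q :
  (raise j s Q)`_(size Q) = - c j * lead_coef Q.
Proof.
rewrite coef_raise [Q`__]nth_default// mulr0 sub0r mulNr coefXM size_poly_eq0.
by case: eqVneq => [->|//]; rewrite lead_coef0.
Qed.

Lemma size_raise j s Q : Q != 0 -> size (raise j s Q) = (size Q).+1.
Proof.
move=> Q0; apply/eqP; rewrite eqn_leq; apply/andP; split.
  apply/leq_sizeP => -[//|k]; rewrite ltnS => Qk; rewrite coef_raise coefXM/=.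
  by rewrite !nth_default ?mulr0 ?subr0// ltnW.
rewrite ltnNge; apply/negP => /leq_sizeP/(_ _ (leqnn _))/eqP.
by rewrite coef_raise_size mulf_eq0 oppr_eq0 lead_coef_eq0 (negPf Q0)
  (negPf (c_neq0 _)).
Qed.

(** Normality: a descent lowers the size of the index by one and, unless the polynomial vanishes,
    its size too. The shift [s] is general because it grows along the induction. *)
Lemma orth_eq0 s (n : multiindex r) P :
  orth s n P -> (size P <= mi_size n)%N -> P = 0.
Proof.
have [m] := ubnP (mi_size n); elim: m s n P => // m IH s n P nm oP.
have [n0|] := posnP (mi_size n).
  by rewrite n0 size_poly_leq0 => /eqP.
move=> /mi_size_gt0P[j nj]; have [Q -> oQ] := orth_descent nj oP.
rewrite (mi_size_pred nj) => sP.
have [->|Q0] := eqVneq Q 0; first by rewrite raise0.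
move: sP; rewrite size_raise// ltnS => sQ.
suff : Q = 0 by move/eqP; rewrite (negPf Q0).
by apply: IH oQ sQ; rewrite -ltnS -(mi_size_pred nj).
Qed.

(** * Monic orthogonal polynomials: subleading coefficient and first free moment *)

Definition orth_monic s (n : multiindex r) (P : {poly R}) : Prop :=
  [/\ P \is monic, size P = (mi_size n).+1 & orth s n P].

(** Since [raise j s] multiplies leading coefficients by [- c j], the monic choice is [- c j] times
    the preimage given by [orth_descent]. *)
Lemma orth_monic_descent s (n : multiindex r) P j :
  (0 < n j)%N -> orth_monic s n P ->
  exists2 Q, P = - (c j)^-1 *: raise j s Q & orth_monic s.+1 (mi_pred n j) Q.
Proof.
move=> nj [/monicP mP sP oP]; have [Q EP oQ] := orth_descent nj oP.
have Q0 : Q != 0.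
  apply/negP => /eqP Q0; move: sP; by rewrite EP Q0 raise0 size_poly0.
have lQ : - c j * lead_coef Q = 1.
  by rewrite -(coef_raise_size _ s) -EP -mP lead_coefE EP size_raise.
have mc : - c j != 0 by rewrite oppr_eq0.
exists (- c j *: Q).
  by rewrite raiseZ scalerA mulrNN mulVf// scale1r.
split.
- by apply/monicP; rewrite lead_coefZ.
- rewrite size_scale// -(mi_size_pred nj).
  by move: sP; rewrite EP size_raise// => -[].
- by move=> i k ik; rewrite -scalerAr linearZ/= (oQ _ _ ik) mulr0.
Qed.

(** The factor ['X] makes the coefficient below the top one read 0 when the index is zero. Along a
    descent [mi_size n] drops as [s] grows, so the factor in front of the sum is invariant, and each
    step in direction [j] contributes one [(c j)^-1] to the sum. *)
Lemma orth_monic_subleading s (n : multiindex r) P : orth_monic s n P ->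
  ('X * P)`_(mi_size n) =
  - ((mi_size n)%:R + al + s%:R) * \sum_(j < r) (n j)%:R / c j.
Proof.
have [m] := ubnP (mi_size n); elim: m s n P => // m IH s n P nm oP.
have [n0|] := posnP (mi_size n).
  rewrite n0 coefXM eqxx big1 ?mulr0// => i _.
  have /eqP := n0; rewrite sum_nat_eq0 => /forallP/(_ i)/eqP ->.
  by rewrite mul0r.
move=> /mi_size_gt0P[j nj]; have [Q EP oQ] := orth_monic_descent nj oP.
have n1 := mi_size_pred nj.
have := IH _ _ _ _ oQ; rewrite -ltnS -n1 => /(_ nm).
case: oQ => /monicP; rewrite lead_coefE => + sQ _; rewrite sQ.
move=> /= Q1 H; rewrite n1 coefXM/= EP coefZ coef_raise Q1 H.
have -> : \sum_(i < r) (n i)%:R / c i =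
    \sum_(i < r) (mi_pred n j i)%:R / c i + (c j)^-1.
  rewrite (bigD1 j)//= [in RHS](bigD1 j)//= mi_pred_same addrAC; congr (_ + _).
    by rewrite -[in LHS](prednK nj) -natr1 mulrDl mul1r.
  by apply: eq_bigr => i ij; rewrite mi_pred_other.
set S := \sum_(i < r) _; rewrite -[in LHS]natr1 -[in RHS]natr1.
by have cj := c_neq0 j; field.
Qed.

(** The first moment under [ell j] left free by orthogonality, relative to a pure moment; see
    [orth_monic_mass]. *)
Definition mass j (n : multiindex r) : R :=
  (n j)`!%:R / c j ^+ n j * \prod_(i < r | i != j) (1 - c j / c i) ^+ n i.

Lemma mass_neq0 j n : mass j n != 0.
Proof.
rewrite !mulf_neq0 ?invr_eq0 ?expf_neq0 ?pnatr_eq0 -?lt0n ?fact_gt0//.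
apply/prodf_neq0 => i ij; rewrite expf_neq0//.
by rewrite -[1](divff (c_neq0 i)) -mulrBl mulf_neq0 ?invr_eq0// subr_eq0 c_neq.
Qed.

Lemma mass_pred_same j (n : multiindex r) : (0 < n j)%N ->
  mass j n = (n j)%:R / c j * mass j (mi_pred n j).
Proof.
move=> nj; rewrite /mass mi_pred_same.
under [in RHS]eq_bigr => i ij do rewrite mi_pred_other//.
case: (n j) nj => // m _; rewrite factS natrM exprS/=.
by have cj := c_neq0 j; field; rewrite expf_neq0.
Qed.

Lemma mass_pred_other j i (n : multiindex r) : i != j -> (0 < n i)%N ->
  mass j n = (1 - c j / c i) * mass j (mi_pred n i).
Proof.
move=> ij ni; rewrite /mass mi_pred_other 1?eq_sym// mulrCA; congr (_ * _).
rewrite (bigD1 i)//= [in RHS](bigD1 i)//= mulrA mi_pred_same -exprS prednK//.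
by congr (_ * _); apply: eq_bigr => k /andP[_ ki]; rewrite mi_pred_other.
Qed.

(** A descent in direction [j] contributes [(n j)%:R / c j], from the second term of [ell_raise];
    one in direction [i != j] contributes [1 - c j / c i], from the first. The exponent
    [s + mi_size n] is invariant. *)
Lemma orth_monic_mass s (n : multiindex r) P j : orth_monic s n P ->
  ell j ('X^(s + n j) * P) = mass j n * ell j 'X^(s + mi_size n).
Proof.
have [m] := ubnP (mi_size n); elim: m s n P => // m IH s n P nm oP.
have [n0|] := posnP (mi_size n).
  have nE i : n i = 0%N.
    by have /eqP := n0; rewrite sum_nat_eq0 => /forallP/(_ i)/eqP.
  case: oP => mP; rewrite n0 => sP _.
  have -> : P = 1.
    have /size_poly1P[t t0 Pt] : size P == 1%N by rewrite sP.
    by move/monicP: mP; rewrite Pt lead_coefC => ->.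
  rewrite nE mulr1 /mass nE expr0 divr1 mul1r big1 ?mul1r// => i _.
  by rewrite nE.
move=> /mi_size_gt0P[i ni]; have [Q EP oQ] := orth_monic_descent ni oP.
have n1 := mi_size_pred ni.
have := IH _ _ _ _ oQ; rewrite -ltnS -n1 => /(_ nm) H.
rewrite EP -scalerAr linearZ/= ell_raise n1 addnS -addSn.
have [ij|ij] := eqVneq i j.
  subst i; rewrite subrr mul0r sub0r (mass_pred_same ni).
  rewrite -[RHS]mulrA -H mi_pred_same.
  have -> : (s.+1 + (n j).-1 = s + n j)%N by lia.
  by ring.
move: H; rewrite mi_pred_other 1?eq_sym// (mass_pred_other ij ni) => H.
(* Either [n j = 0], or this is the last condition on [Q] at [j], because
   [s + n j = s.+1 + (n j).-1]. *)
have -> : (n j)%:R * ell j ('X^(s + n j) * Q) = 0.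
  case: oQ => _ _ /(_ j (n j).-1).
  rewrite mi_pred_other 1?eq_sym//; case: (n j) => [|k]; first by rewrite mul0r.
  by rewrite addSnnS => ->; rewrite ?mulr0 /=.
rewrite subr0 H.
by have ci := c_neq0 i; field.
Qed.

Lemma orth_monic_mass_neq0 s (n : multiindex r) P j : orth_monic s n P ->
  ell j ('X^(s + n j) * P) != 0.
Proof. by move=> oP; rewrite orth_monic_mass// mulf_neq0 ?mass_neq0. Qed.

(** * The nearest neighbor recurrence for a family of monic orthogonal polynomials *)

Context (L : multiindex r -> {poly R}).
Hypothesis oL : forall n, orth_monic 0 n (L n).

Let monicL n : (L n)`_(mi_size n) = 1.
Proof. by have [/monicP + sL _] := oL n; rewrite lead_coefE sL. Qed.

Let orthL (n : multiindex r) j k : (k < n j)%N -> ell j ('X^k * L n) = 0.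
Proof. by have [_ _] := oL n; apply. Qed.

Let neighbors (f : 'I_r -> R) (n : multiindex r) : {poly R} :=
  \sum_(j < r | (0 < n j)%N) f j *: L (mi_pred n j).

(** The coefficient of [L n] is the difference of the subleading coefficients of [L n] and
    [L (mi_succ n k)]. The neighbors have lower degree, so [f] is arbitrary and both directions of
    the equivalence can use this. *)
Lemma recurrence_coef (n : multiindex r) k f : ('X * L n)`_(mi_size n) =
  (L (mi_succ n k) +
     (((mi_size n)%:R + al + 1) / c k + \sum_(j < r) (n j)%:R / c j) *: L n +
     neighbors f n)`_(mi_size n).
Proof.
rewrite !coefD coefZ monicL mulr1 coef_sum.
rewrite [X in _ + X]big1 => [|j nj]; last first.
  rewrite coefZ nth_default ?mulr0// (mi_size_pred nj).
  by have [_ -> _] := oL (mi_pred n j).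
rewrite addr0; have := orth_monic_subleading (oL (mi_succ n k)).
rewrite mi_size_succ coefXM/= => ->.
rewrite (orth_monic_subleading (oL n)).
have -> : \sum_(j < r) (mi_succ n k j)%:R / c j =
    \sum_(j < r) (n j)%:R / c j + (c k)^-1.
  under eq_bigr do rewrite ffunE natrD mulrDl.
  rewrite big_split/=; congr (_ + _); rewrite (bigD1 k)//= eqxx mul1r.
  by rewrite big1 ?addr0// => i /negPf ->; rewrite mul0r.
by rewrite -natr1; have ck := c_neq0 k; field.
Qed.

Lemma ell_XnS j N : ell j 'X^(N.+1) = (N.+1%:R + al) / c j * ell j 'X^N.
Proof.
have := ell_ibp j 'X^N; rewrite derivXn -exprS.
have -> : 'X * ('X^(N.-1) *+ N) = N%:R *: 'X^N :> {poly R}.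
  case: N => [|N]; first by rewrite mulr0n mulr0 scale0r.
  by rewrite /= mulrnAr -exprS scaler_nat.
rewrite linearZ/= => H.
apply: (mulfI (c_neq0 j)); rewrite -natr1.
have -> : c j * ell j 'X^(N.+1) = N%:R * ell j 'X^N + (al + 1) * ell j 'X^N.
  by rewrite H; ring.
by have cj := c_neq0 j; field.
Qed.

(** Quotient of two instances of [orth_monic_mass]: the masses contribute [(n j)%:R / c j], the pure
    moments [((mi_size n)%:R + al) / c j]. *)
Lemma top_moment (n : multiindex r) j : (0 < n j)%N ->
  ell j ('X^(n j) * L n) = ((mi_size n)%:R + al) * (n j)%:R / c j ^+ 2 *
    ell j ('X^((n j).-1) * L (mi_pred n j)).
Proof.
move=> nj; have := orth_monic_mass j (oL n); rewrite !add0n => ->.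
have := orth_monic_mass j (oL (mi_pred n j)); rewrite !add0n mi_pred_same => ->.
rewrite (mass_pred_same nj) (mi_size_pred nj) ell_XnS.
by have cj := c_neq0 j; field.
Qed.

(** The bound is on [k.+1] because [L (mi_pred n i)] has one condition fewer at [i]. *)
Lemma neighbors_orth (n : multiindex r) i k f : (k.+1 < n i)%N ->
  ell i ('X^k * neighbors f n) = 0.
Proof.
move=> kn; rewrite mulr_sumr linear_sum big1// => j nj.
rewrite -scalerAr linearZ/= orthL ?mulr0//.
have [<-|ij] := eqVneq i j; first by rewrite mi_pred_same ltn_predRL.
by rewrite mi_pred_other// ltnW.
Qed.

(** Only [L (mi_pred n i)] has lost the condition at exponent [(n i).-1], so this test isolates
    [f i]. *)
Lemma neighbors_top (n : multiindex r) i f : (0 < n i)%N ->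
  ell i ('X^((n i).-1) * neighbors f n) =
  f i * ell i ('X^((n i).-1) * L (mi_pred n i)).
Proof.
move=> ni; rewrite mulr_sumr linear_sum (bigD1 i)//= -scalerAr linearZ/=.
rewrite big1 ?addr0// => j /andP[nj ji].
rewrite -scalerAr linearZ/= orthL ?mulr0// mi_pred_other 1?eq_sym//.
by rewrite prednK.
Qed.

Lemma size_neighbors (n : multiindex r) f :
  (size (neighbors f n) <= mi_size n)%N.
Proof.
apply: (leq_trans (size_sum _ _ _)); apply/bigmax_leqP => j nj.
apply: (leq_trans (size_scale_leq _ _)); rewrite (mi_size_pred nj).
by have [_ -> _] := oL (mi_pred n j).
Qed.

Let orthL_succ (n : multiindex r) k i l :
  (l < n i)%N -> ell i ('X^l * L (mi_succ n k)) = 0.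
Proof. by move=> ln; rewrite orthL// ffunE ltn_addr. Qed.

Let XpredM (m : nat) (p : {poly R}) :
  (0 < m)%N -> 'X^(m.-1) * ('X * p) = 'X^m * p.
Proof. by move=> m0; rewrite mulrA -exprSr prednK. Qed.

Lemma nearest_neighbor_recurrence_orth (a b : multiindex r -> 'I_r -> R) :
  nearest_neighbor_recurrence L a b <->
  (forall (n : multiindex r) (j : 'I_r),
     a n j = ((mi_size n)%:R + al) * (n j)%:R / c j ^+ 2) /\
  (forall (n : multiindex r) (k : 'I_r),
     b n k = ((mi_size n)%:R + al + 1) / c k + \sum_(j < r) (n j)%:R / c j).
Proof.
split=> [[a0 rec]|[aE bE]]; split=> [n j|n k].
- have [n0|nj] := posnP (n j); first by rewrite a0 // n0 mulr0 mul0r.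
  (* This test annihilates [L (mi_succ n j)], [L n] and every neighbor but [L (mi_pred n j)]; the
     left side becomes the top moment of [L n]. *)
  have /(congr1 (fun p => ell j ('X^((n j).-1) * p))) := rec n j.
  rewrite XpredM// !mulrDr !(linearD (ell j)) neighbors_top//.
  rewrite -scalerAr linearZ/=.
  rewrite orthL_succ ?prednK// [ell j ('X^(_.-1) * L n)]orthL ?prednK//.
  rewrite mulr0 !add0r top_moment//.
  move/esym; apply: mulIf.
  by have := orth_monic_mass_neq0 j (oL (mi_pred n j)); rewrite mi_pred_same.
- have /(congr1 (fun p : {poly R} => p`_(mi_size n))) := rec n k.
  rewrite (recurrence_coef n k (a n)) !coefD => /addIr/addrI/esym.
  by rewrite !coefZ monicL !mulr1.
- by move=> nj; rewrite aE nj mulr0 mul0r.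
apply/eqP; rewrite -subr_eq0; apply/eqP.
(* The defect [D] of the recurrence vanishes by normality once it is shown orthogonal for [n] and of
   size at most [mi_size n]. *)
rewrite -[X in _ - (_ + X)]/(neighbors (a n) n); set D := _ - _.
apply: (@orth_eq0 0 n).
  move=> i l ln; rewrite add0n /D mulrBr !mulrDr.
  rewrite (linearB (ell i)) !(linearD (ell i)).
  rewrite -scalerAr linearZ/= orthL_succ// orthL// mulr0 !add0r.
  have [ln1|] := ltnP l.+1 (n i).
    by rewrite neighbors_orth// subr0 mulrA -exprSr orthL.
  (* At the last condition, [l = (n i).-1], the value of [a n i] makes the two top moments
     cancel. *)
  rewrite leq_eqVlt ltnNge ln orbF => /eqP nl.
  have ni : (0 < n i)%N by rewrite nl.
  have -> : l = (n i).-1 by rewrite nl.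
  by rewrite XpredM// neighbors_top// top_moment// aE subrr.
(* Degree [mi_size n] cancels by the value of [b n k], the next degree because both sides are monic
   there; above it everything is zero. *)
apply/leq_sizeP => l; rewrite leq_eqVlt => /predU1P[<-|ln].
  by rewrite /D coefB (recurrence_coef n k (a n)) bE subrr.
have sL m : size (L m) = (mi_size m).+1 by have [_ ->] := oL m.
rewrite /D coefB !coefD coefZ coefXM (gtn_eqF (leq_ltn_trans _ ln))//.
rewrite [(neighbors _ _)`_l]nth_default; last first.
  exact: leq_trans (size_neighbors _ _) (ltnW ln).
rewrite [(L n)`_l]nth_default ?sL// mulr0 !addr0.
move: ln; rewrite leq_eqVlt => /predU1P[<-|ln].
  have := monicL (mi_succ n k).
  by rewrite mi_size_succ monicL => ->; rewrite subrr.
rewrite !nth_default ?subrr// sL ?mi_size_succ//.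
by rewrite -ltnS prednK// (leq_ltn_trans _ ln).
Qed.

End algebra.

(** * Integrals over the open half-line by exhaustion with compact intervals *)

Section halfline.
Context (R : realType).
Notation mu := (@lebesgue_measure R).

(** With [n.+2] the interval is nondegenerate already at [n = 0], as [FTC2_gt0] requires. *)
Let lo n : R := n.+2%:R^-1.
Let hi n : R := n.+2%:R.

Let lo_gt0 n : 0 < lo n. Proof. by rewrite invr_gt0. Qed.

Let lo_lt_hi n : lo n < hi n.
Proof. by rewrite (@lt_trans _ _ 1)// ?invf_lt1 ?ltr1n. Qed.

Let itvcc_sub n : `[lo n, hi n] `<=` `](0 : R), +oo[.
Proof.
move=> x /=; rewrite !in_itv/= andbT => /andP[nx _].
exact: lt_le_trans (lo_gt0 n) nx.
Qed.

Lemma itv0y_bigcup_cc :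
  `](0 : R), +oo[%classic = \bigcup_n `[lo n, hi n]%classic.
Proof.
apply/seteqP; split => [x|x [n _]] /=; rewrite !in_itv/= ?andbT; last first.
  by move=> /andP[nx _]; exact: lt_le_trans nx.
move=> x0; pose m := maxn (Num.truncn x) (Num.truncn x^-1).
exists m => //=; rewrite in_itv/= /lo /hi; apply/andP; split.
  rewrite -[leRHS]invrK lef_pV2 ?posrE ?invr_gt0//.
  rewrite (le_trans (ltW (truncnS_gt _)))// ler_nat ltnS.
  by rewrite (leq_trans (leq_maxr _ _) (leqnSn _)).
rewrite (le_trans (ltW (truncnS_gt _)))// ler_nat ltnS.
by rewrite (leq_trans (leq_maxl _ _) (leqnSn _)).
Qed.

Lemma ge0_cvg_integral_itv0y (f : R -> R) :
  measurable_fun `](0 : R), +oo[ f -> (forall x : R, 0 < x -> 0 <= f x) ->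
  (\int[mu]_(x in `[lo n, hi n]) (f x)%:E)%E @[n --> \oo] -->
  (\int[mu]_(x in `]0%R, +oo[) (f x)%:E)%E.
Proof.
move=> mf f0; rewrite itv0y_bigcup_cc.
apply: ge0_nondecreasing_set_cvg_integral => //.
- move=> m n mn; rewrite subsetEset; apply: subset_itv; rewrite bnd_simp.
    by rewrite lef_pV2 ?posrE// ler_nat !ltnS.
  by rewrite ler_nat !ltnS.
- move=> n; apply/measurable_EFinP; apply: measurable_funS mf => //.
- move=> n x /=; rewrite in_itv/= => /andP[nx _].
  by rewrite lee_fin f0// (lt_le_trans _ nx).
Qed.

Lemma FTC2_gt0 (F f : R -> R) (a b : R) : 0 < a -> a < b ->
  (forall x : R, 0 < x -> is_derive x 1 F (f x)) ->
  (forall x : R, 0 < x -> {for x, continuous f}) ->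
  (\int[mu]_(x in `[a, b]) (f x)%:E = (F b)%:E - (F a)%:E)%E.
Proof.
move=> a0 ab dF cf.
have cF x : 0 < x -> {for x, continuous F}.
  move=> x0; apply/differentiable_continuous/derivable1_diffP.
  by have [] := dF x x0.
apply: continuous_FTC2 => //.
- apply: continuous_in_subspaceT => x; rewrite inE/= in_itv/= => /andP[ax _].
  by apply: cf; rewrite (lt_le_trans a0).
- split.
  + move=> x; rewrite in_itv/= => /andP[ax _].
    by have [] := dF x (lt_trans a0 ax).
  + exact/cvg_at_right_filter/cF.
  + exact/cvg_at_left_filter/cF/(lt_trans a0).
- move=> x; rewrite in_itv/= => /andP[ax _].
  by rewrite derive1E; have [] := dF x (lt_trans a0 ax).
Qed.

Lemma continuous_gt0_measurable (f : R -> R) :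
  (forall x : R, 0 < x -> {for x, continuous f}) ->
  measurable_fun `](0 : R), +oo[ f.
Proof.
move=> cf; apply: open_continuous_measurable_fun => //.
by move=> x; rewrite inE/= in_itv/= andbT; exact: cf.
Qed.

(* Both sides may be infinite. *)
Lemma ge0_integral_itv0y_eq (F g h : R -> R) :
  (forall x : R, 0 < x -> is_derive x 1 F (g x - h x)) ->
  (forall x : R, 0 < x -> {for x, continuous g}) ->
  (forall x : R, 0 < x -> {for x, continuous h}) ->
  (forall x : R, 0 < x -> 0 <= g x) -> (forall x : R, 0 < x -> 0 <= h x) ->
  F (lo n) @[n --> \oo] --> (0 : R) -> F (hi n) @[n --> \oo] --> (0 : R) ->
  (\int[mu]_(x in `]0%R, +oo[) (g x)%:E = \int[mu]_(x in `]0%R, +oo[) (h x)%:E)%E.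
Proof.
move=> dF cg ch g0 h0 F0 Foo.
have mg := continuous_gt0_measurable cg.
have mh := continuous_gt0_measurable ch.
have Ig := ge0_cvg_integral_itv0y mg g0.
have Ih := ge0_cvg_integral_itv0y mh h0.
have D0 : (F (hi n) - F (lo n))%:E @[n --> \oo] --> (0 : R)%:E.
  apply: cvg_EFin; first exact: nearW.
  by rewrite -[0 : R]subr0; apply: cvgB.
have int f n : (forall x : R, 0 < x -> {for x, continuous f}) ->
    mu.-integrable `[lo n, hi n] (EFin \o f).
  move=> cf; apply: continuous_compact_integrable; first exact: segment_compact.
  apply: continuous_in_subspaceT => x; rewrite inE/= in_itv/= => /andP[nx _].
  by apply: cf; rewrite (lt_le_trans _ nx).
(* On a compact interval both integrals are finite, so the integral of [g - h] can be split. *)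
have E n : (\int[mu]_(x in `[lo n, hi n]) (g x)%:E =
    (F (hi n) - F (lo n))%:E + \int[mu]_(x in `[lo n, hi n]) (h x)%:E)%E.
  rewrite EFinB -(@FTC2_gt0 F (fun x => g x - h x))//; last first.
    by move=> x x0; apply: cvgB; [exact: cg|exact: ch].
  under [X in (X + _)%E]eq_integral do rewrite EFinB.
  rewrite integralB_EFin//; [|exact: int|exact: int].
  by rewrite subeK// integrable_fin_num//; exact: int.
suff : (\int[mu]_(x in `[lo n, hi n]) (g x)%:E)%E @[n --> \oo] -->
    (\int[mu]_(x in `]0%R, +oo[) (h x)%:E)%E.
  exact: (@cvg_unique _ (@ereal_hausdorff R) _ _ _ _ Ig).
under eq_cvg do rewrite E.
have := cvgeD (fin_num_adde_defr _ _) D0 Ih; rewrite add0e; exact.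
Qed.

(** Comparison test: each truncated integral of [f] is at most the increment of the primitive [F] of
    [g], hence at most [M]. *)
Lemma ge0_integral_itv0y_lty (F f g : R -> R) (M : R) :
  (forall x : R, 0 < x -> is_derive x 1 F (g x)) ->
  (forall x : R, 0 < x -> {for x, continuous g}) ->
  (forall x : R, 0 < x -> {for x, continuous f}) ->
  (forall x : R, 0 < x -> 0 <= f x <= g x) ->
  (forall x : R, 0 < x -> 0 <= F x <= M) ->
  (\int[mu]_(x in `]0%R, +oo[) (f x)%:E < +oo)%E.
Proof.
move=> dF cg cf fg FM.
have mf := continuous_gt0_measurable cf.
have mg := continuous_gt0_measurable cg.
have f0 x : 0 < x -> 0 <= f x by move=> /fg/andP[].
have If := ge0_cvg_integral_itv0y mf f0.
apply: (@le_lt_trans _ _ M%:E); last by rewrite ltry.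
rewrite -(cvg_lim _ If)//; apply: lime_le.
  by apply/cvg_ex; eexists; exact: If.
apply: nearW => n.
have sub := @itvcc_sub n.
have pos x : `[lo n, hi n]%classic x -> 0 < x.
  by move=> /sub/=; rewrite in_itv/= andbT.
apply: (@le_trans _ _ (\int[mu]_(x in `[lo n, hi n]) (g x)%:E)%E).
  apply: ge0_le_integral => //.
  - by move=> x /pos x0; rewrite lee_fin f0.
  - by apply/measurable_EFinP; exact: measurable_funS mf.
  - by apply/measurable_EFinP; exact: measurable_funS mg.
  - by move=> x /pos/fg/andP[_]; rewrite lee_fin.
rewrite (FTC2_gt0 _ _ dF)// -EFinB lee_fin.
have /andP[_ h1] := FM _ (lt_trans (lo_gt0 n) (lo_lt_hi n)).
have /andP[l0 _] := FM _ (lo_gt0 n).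
by rewrite lerBlDr (le_trans h1)// lerDl.
Qed.

End halfline.

(** * Moments of the Laguerre weight: recursion, finiteness, positivity *)

Section moments.
Context (R : realType) (c : R).
Hypothesis c_gt0 : 0 < c.
Notation mu := (@lebesgue_measure R).

Definition laguerre_weight (b x : R) : R := x `^ b * expR (- (c * x)).
Local Notation w := laguerre_weight.

Lemma laguerre_weight_ge0 b x : 0 <= w b x.
Proof. by rewrite mulr_ge0 ?powR_ge0 ?expR_ge0. Qed.

Lemma laguerre_weight_gt0 b x : 0 < x -> 0 < w b x.
Proof. by move=> x0; rewrite mulr_gt0 ?powR_gt0 ?expR_gt0. Qed.

Lemma is_derive_laguerre_weight b (x : R) : 0 < x ->
  is_derive x 1 (w b) (b * w (b - 1) x - c * w b x).
Proof.
move=> x0.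
have dp := is_derive1_powR b x0.
have de : is_derive x 1 (fun y : R => expR (- (c * y))) (- c * expR (- (c * x))).
  have dl : is_derive x 1 (fun y : R => - (c * y)) (- c).
    have := @is_deriveN _ _ _ _ _ _ _
      (@is_deriveZ _ _ _ id c x 1 1 (is_derive_id _ _)).
    by rewrite /GRing.scale/= mulr1.
  have := @is_derive1_comp _ expR (fun y : R => - (c * y)) x _ _ (is_derive_expR _) dl.
  by rewrite [X in is_derive _ _ _ X]mulrC.
have := is_deriveM dp de.
rewrite /w /GRing.scale/=.
by move=> H; apply: (is_derive_eq H); ring.
Qed.

Lemma continuous_laguerre_weight b (x : R) : 0 < x -> {for x, continuous (w b)}.
Proof.
move=> x0; apply/differentiable_continuous/derivable1_diffP.
by have [] := is_derive_laguerre_weight b x0.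
Qed.

Let inv_natSS_cvg0 : (n.+2%:R^-1 : R) @[n --> \oo] --> (0 : R).
Proof.
have := @cvg_harmonic R; rewrite -cvg_shiftS; exact.
Qed.

Lemma laguerre_weight_cvg0 (b : R) : 0 < b ->
  w b n.+2%:R^-1 @[n --> \oo] --> (0 : R).
Proof.
move=> b0.
apply: (@squeeze_cvgr _ _ _ _ (fun=> 0) (fun n => (n.+2%:R^-1) `^ b)).
- apply: nearW => n; rewrite laguerre_weight_ge0/= ler_piMr ?powR_ge0//.
  by rewrite expR_le1 oppr_le0 mulr_ge0// ltW.
- exact: cvg_cst.
- have /cvg_at_rightP := powR_cvg0 b0; apply; split => // n.
Qed.

(* [s x <= exp (s x)] with [s = c / (b + 1)] gives [w b x <= C / x]. *)
Lemma laguerre_weight_cvgy (b : R) : 0 < b -> w b n.+2%:R @[n --> \oo] --> (0 : R).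
Proof.
move=> b0; pose s := c / (b + 1).
have s0 : 0 < s by rewrite divr_gt0// addr_gt0.
apply: (@squeeze_cvgr _ _ _ _ (fun=> 0) (fun n => s `^ (- (b + 1)) * n.+2%:R^-1)).
- apply: nearW => n; rewrite laguerre_weight_ge0/=.
  set x := n.+2%:R; have x0 : 0 < x by rewrite ltr0n.
  rewrite ler_pdivlMr// powRN -[leRHS]mul1r ler_pdivlMr ?powR_gt0//.
  have -> : w b x * x * s `^ (b + 1) = (s * x) `^ (b + 1) * expR (- (c * x)).
    rewrite powRM ?(ltW s0) ?(ltW x0)// [x `^ (b + 1)]powRD; last first.
      by rewrite (gt_eqF x0) implybT.
    by rewrite powRr1 ?(ltW x0)// /laguerre_weight; ring.
  rewrite expRN ler_pdivrMr ?expR_gt0// mul1r.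
  have -> : c * x = s * x * (b + 1).
    by rewrite mulrAC divfK// gt_eqF// addr_gt0.
  rewrite expRM ge0_ler_powR ?nnegrE ?expR_ge0//.
  - by rewrite addr_ge0// ltW.
  - by rewrite mulr_ge0 ?ltW.
  - by rewrite (le_trans _ (expR_ge1Dx _))// lerDr.
- exact: cvg_cst.
- by rewrite -[X in _ --> X](mulr0 (s `^ (- (b + 1)))); apply: cvgM; [exact: cvg_cst|].
Qed.

(** Integrates the derivative of [w (b + 1)], which tends to 0 at both ends because [b + 1 > 0]. The
    identity is in the extended reals, so finiteness can be proved separately. *)
Lemma laguerre_weight_integral_rec (b : R) : -1 < b ->
  ((b + 1)%:E * \int[mu]_(x in `]0%R, +oo[) (w b x)%:E =
   c%:E * \int[mu]_(x in `]0%R, +oo[) (w (b + 1) x)%:E)%E.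
Proof.
move=> b1; have b0 : 0 < b + 1 by rewrite -ltrBlDr sub0r.
have mw d : measurable_fun `](0 : R), +oo[ (EFin \o w d).
  apply/measurable_EFinP; apply: continuous_gt0_measurable.
  exact: continuous_laguerre_weight.
have Z k d : 0 <= k -> (k%:E * \int[mu]_(x in `]0%R, +oo[) (w d x)%:E =
    \int[mu]_(x in `]0%R, +oo[) (k * w d x)%:E)%E.
  move=> k0; rewrite -ge0_integralZl_EFin//; last exact: mw.
  by move=> x _; rewrite lee_fin laguerre_weight_ge0.
rewrite !Z ?(ltW b0) ?(ltW c_gt0)//.
apply: (@ge0_integral_itv0y_eq R (w (b + 1))).
- by move=> x x0; have := is_derive_laguerre_weight (b + 1) x0; rewrite addrK.
- by move=> x x0; apply: cvgM; [exact: cvg_cst|]; exact: continuous_laguerre_weight.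
- by move=> x x0; apply: cvgM; [exact: cvg_cst|]; exact: continuous_laguerre_weight.
- by move=> x x0; rewrite mulr_ge0 ?laguerre_weight_ge0// ltW.
- by move=> x x0; rewrite mulr_ge0 ?laguerre_weight_ge0// ltW.
- exact: laguerre_weight_cvg0.
- exact: laguerre_weight_cvgy.
Qed.

Lemma laguerre_weight_integral_lty (b : R) : -1 < b ->
  (\int[mu]_(x in `]0%R, +oo[) (w b x)%:E < +oo)%E.
Proof.
move=> b1; have b0 : 0 < b + 1 by rewrite -ltrBlDr sub0r.
(* [g] is the derivative of [u ^ (b + 1) / (b + 1)] and equals
   [x ^ b / (1 + t x) ^ p], which dominates the weight since
   [(1 + t x) ^ p <= exp (t p x) = exp (c x)]. *)
pose p := b + 2; have p0 : 0 < p by rewrite /p; lra.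
pose t := c / p; have t0 : 0 < t by rewrite divr_gt0.
have d0 (x : R) : 0 < x -> 0 < 1 + t * x.
  by move=> x0; rewrite ltr_wpDr// mulr_ge0// ltW.
pose u (x : R) := x / (1 + t * x).
have u0 (x : R) : 0 < x -> 0 < u x by move=> x0; rewrite divr_gt0// d0.
pose g x := u x `^ b * (1 - t * u x) ^+ 2.
have uE (x : R) : 0 < x -> 1 - t * u x = (1 + t * x)^-1.
  by move=> x0; have := d0 _ x0; rewrite /u => d; field; rewrite gt_eqF.
have du (x : R) : 0 < x -> is_derive x 1 u ((1 - t * u x) ^+ 2).
  move=> x0; have q0 : 1 + t * x != 0 by rewrite gt_eqF// d0.
  have dq : is_derive x 1 (fun y : R => 1 + t * y) t.
    have := is_deriveD (is_derive_cst (1 : R) x 1) (is_deriveZ t (is_derive_id x 1)).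
    by move=> H; apply: (is_derive_eq H); rewrite add0r /GRing.scale/= mulr1.
  have := is_deriveM (is_derive_id x 1)
    (@is_deriveV _ (fun y : R => 1 + t * y) x t 1 q0 dq).
  move=> H; apply: (is_derive_eq H); rewrite uE// /GRing.scale/=.
  by field.
have cu (x : R) : 0 < x -> {for x, continuous u}.
  move=> x0; apply/differentiable_continuous/derivable1_diffP.
  by have [] := du x x0.
have dF (x : R) : 0 < x ->
    is_derive x 1 (fun y => (b + 1)^-1 * u y `^ (b + 1)) (g x).
  move=> x0; have := @is_derive1_comp _ (fun z : R => z `^ (b + 1)) u x _ _
    (is_derive1_powR _ (u0 _ x0)) (du _ x0).
  rewrite addrK => H; have := @is_deriveZ _ _ _ _ (b + 1)^-1 x 1 _ H.
  rewrite /GRing.scale/= => {}H; apply: is_derive_eq.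
  by rewrite /g -mulrA mulKf ?gt_eqF.
apply: (@ge0_integral_itv0y_lty R _ (w b) g ((b + 1)^-1 * t^-1 `^ (b + 1)) dF).
- move=> x x0; apply: cvgM; last first.
    by apply: cvgM; apply: cvgB; (try exact: cvg_cst);
      apply: cvgM; (try exact: cvg_cst); exact: cu.
  apply: (@continuous_comp _ _ _ u (fun z : R => z `^ b)); first exact: cu.
  apply/differentiable_continuous/derivable1_diffP.
  by have [] := is_derive1_powR b (u0 _ x0).
- exact: continuous_laguerre_weight.
- move=> x x0; rewrite laguerre_weight_ge0/= /g uE//.
  set q := 1 + t * x; have q0 : 0 < q by exact: d0.
  have qV : q^-1 `^ p = (q `^ p)^-1.
    apply: (mulfI (lt0r_neq0 (powR_gt0 p q0))).
    rewrite -powRM ?invr_ge0 ?(ltW q0)// !mulfV ?powR1//.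
      by rewrite gt_eqF// powR_gt0.
    by rewrite gt_eqF.
  (* The exponent [b] from the power of [u x] and the 2 from the square add up to [p], and
     [t * p = c]. *)
  rewrite /u powRM ?invr_ge0 ?(ltW q0) ?(ltW x0)// -mulrA ler_pM2l ?powR_gt0//.
  rewrite -powR_mulrn ?invr_ge0 ?(ltW q0)// -powRD; last first.
    by rewrite invr_eq0 (gt_eqF q0) implybT.
  rewrite qV expRN lef_pV2 ?posrE ?expR_gt0 ?powR_gt0//.
  have -> : c * x = t * x * p by rewrite mulrAC divfK// gt_eqF.
  by rewrite expRM ge0_ler_powR ?nnegrE ?expR_ge0 ?(ltW p0) ?(ltW q0)// expR_ge1Dx.
(* The primitive is bounded because [u x <= t^-1]. *)
- move=> x x0; rewrite mulr_ge0 ?invr_ge0 ?powR_ge0 ?(ltW b0)//=.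
  rewrite ler_pM2l ?invr_gt0// ge0_ler_powR ?nnegrE ?(ltW b0) ?(ltW (u0 _ x0))//.
    by rewrite invr_ge0 ltW.
  rewrite /u ler_pdivrMr ?d0// mulrDr mulr1 mulrA mulVf ?gt_eqF// mul1r.
  by rewrite lerDr invr_ge0 ltW.
Qed.

Let D := `]0%R : R, +oo[%classic.

Lemma laguerre_weight_measurable b : measurable_fun D (w b).
Proof.
by apply: continuous_gt0_measurable; exact: continuous_laguerre_weight.
Qed.

Lemma laguerre_weight_integrable b : -1 < b -> mu.-integrable D (EFin \o w b).
Proof.
move=> b1; apply/integrableP; split.
  by apply/measurable_EFinP; exact: laguerre_weight_measurable.
under eq_integral => x _ do rewrite /= ger0_norm ?laguerre_weight_ge0//.
exact: laguerre_weight_integral_lty.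
Qed.

(** A zero integral would make the positive weight vanish almost everywhere, and the half-line a
    null set. *)
Lemma laguerre_weight_integral_gt0 b :
  (0 < \int[mu]_(x in D) (w b x)%:E)%E.
Proof.
rewrite lt_neqAle integral_ge0 ?andbT; last first.
  by move=> x _; rewrite lee_fin laguerre_weight_ge0.
apply/negP => /eqP I0.
have mD : measurable D by exact: measurable_itv.
have mw : measurable_fun D (EFin \o w b).
  by apply/measurable_EFinP; exact: laguerre_weight_measurable.
have [+ _] := ae_eq_integral_abs mu mD mw.
under eq_integral => x _ do rewrite /= ger0_norm ?laguerre_weight_ge0//.
move=> /(_ (esym I0)) [N [mN N0 DN]].
have : (mu D <= mu N)%E.
  apply: le_measure; rewrite ?inE// => x Dx; apply: DN => /= /(_ Dx) [] w0.
  move: Dx; rewrite /D/= in_itv/= andbT => /(laguerre_weight_gt0 b).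
  by rewrite w0 ltxx.
by rewrite N0 lebesgue_measure_itv/= ltry.
Qed.

(** Classically Gamma(b + 1) / c^(b + 1) for [-1 < b]; [fine] would send an infinite integral to
    0. *)
Definition laguerre_moment (b : R) : R := fine (\int[mu]_(x in D) (w b x)%:E)%E.

Lemma laguerre_momentE b : -1 < b ->
  (\int[mu]_(x in D) (w b x)%:E = (laguerre_moment b)%:E)%E.
Proof.
move=> b1; rewrite fineK//; apply: integrable_fin_num.
  exact: measurable_itv.
exact: laguerre_weight_integrable.
Qed.

Lemma laguerre_moment_gt0 b : -1 < b -> 0 < laguerre_moment b.
Proof.
by move=> b1; rewrite -lte_fin -laguerre_momentE// laguerre_weight_integral_gt0.
Qed.

Lemma laguerre_moment_rec b : -1 < b ->
  (b + 1) * laguerre_moment b = c * laguerre_moment (b + 1).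
Proof.
move=> b1; have := laguerre_weight_integral_rec b1.
by rewrite !laguerre_momentE//; [move=> []|lra].
Qed.

End moments.

(** * The linear functional on polynomials with prescribed moments *)

Section moment_form.
Context (R : comNzRingType) (m : nat -> R).

Definition moment_form (p : {poly R}) : R := \sum_(i < size p) p`_i * m i.

Lemma moment_form_widen n (p : {poly R}) : (size p <= n)%N ->
  moment_form p = \sum_(i < n) p`_i * m i.
Proof.
move=> pn; rewrite /moment_form (big_ord_widen _ (fun i => p`_i * m i) pn).
rewrite big_mkcond; apply: eq_bigr => i _; case: ltnP => // ?.
by rewrite nth_default ?mul0r.
Qed.

Lemma moment_form_is_linear : scalar moment_form.
Proof.
move=> a p q; set n := maxn (size (a *: p + q)) (maxn (size p) (size q)).
rewrite !(@moment_form_widen n) /n; try by rewrite !leq_max leqnn ?orbT.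
rewrite mulr_sumr -big_split; apply: eq_bigr => i _ /=.
by rewrite coefD coefZ mulrDl mulrA.
Qed.

HB.instance Definition _ :=
  GRing.isLinear.Build R {poly R} R *%R moment_form moment_form_is_linear.

Lemma moment_formXn n : moment_form 'X^n = m n.
Proof.
rewrite /moment_form size_polyXn big_ord_recr/= coefXn eqxx mul1r big1 ?add0r//.
by move=> i _; rewrite coefXn ltn_eqF// mul0r.
Qed.

End moment_form.

(** * The Laguerre functionals satisfy the algebraic hypotheses *)

Section laguerre_form.
Context (R : realType) (al : R).
Hypothesis al1 : -1 < al.
Notation mu := (@lebesgue_measure R).

(** Built from the moments, so that linearity is algebraic; [laguerre_form_integral] identifies it
    with the integral. *)
Definition laguerre_form (c : R) : {scalar {poly R}} :=
  moment_form (fun k => laguerre_moment c (al + k%:R)).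

Let al1D k : -1 < al + k%:R.
Proof. by rewrite (lt_le_trans al1)// lerDl. Qed.

Lemma laguerre_form_integral c (p : {poly R}) : 0 < c ->
  (\int[mu]_(x in `]0%R, +oo[) (p.[x] * x `^ al * expR (- (c * x)))%:E =
   (laguerre_form c p)%:E)%E.
Proof.
move=> c0.
have mD : measurable `]0%R : R, +oo[%classic by exact: measurable_itv.
transitivity (\int[mu]_(x in `]0%R, +oo[) \sum_(i < size p)
    ((p`_i)%:E * (laguerre_weight c (al + i%:R) x)%:E))%E.
  apply: eq_integral => x; rewrite inE/= in_itv/= andbT => x0.
  rewrite horner_coef !mulr_suml -sumEFin; apply: eq_bigr => i _.
  rewrite -EFinM; congr EFin; rewrite /laguerre_weight powRD; last first.
    by rewrite (gt_eqF x0) implybT.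
  by rewrite powR_mulrn ?(ltW x0)//; ring.
rewrite integral_sum//; last first.
  by move=> i; apply: integrableZl => //; exact: laguerre_weight_integrable.
rewrite /laguerre_form/= /moment_form -sumEFin; apply: eq_bigr => i _.
rewrite integralZl//; last exact: laguerre_weight_integrable.
by rewrite laguerre_momentE// EFinM.
Qed.

Lemma laguerre_form_Xn_neq0 c n : 0 < c -> laguerre_form c 'X^n != 0.
Proof.
by move=> c0; rewrite /laguerre_form/= moment_formXn gt_eqF// laguerre_moment_gt0.
Qed.

(** By linearity it suffices to treat monomials, where this is [laguerre_moment_rec] at exponent
    [al + i%:R]. *)
Lemma laguerre_form_ibp c (p : {poly R}) : 0 < c ->
  laguerre_form c ('X * p^`()) =
  - (al + 1) * laguerre_form c p + c * laguerre_form c ('X * p).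
Proof.
move=> c0; rewrite -[p]coefK poly_def.
elim/big_rec: _ => [|i q _ IH].
  by rewrite deriv0 !mulr0 !linear0 !mulr0 addr0.
rewrite derivD !mulrDr !(linearD (laguerre_form c)) IH !mulrDr addrACA.
congr (_ + _).
rewrite derivZ -!scalerAr !linearZ/= derivXn -exprS !moment_formXn.
have -> : 'X * ('X^(i.-1) *+ i) = i%:R *: 'X^i :> {poly R}.
  case: (val i) => [|k]; first by rewrite mulr0n mulr0 scale0r.
  by rewrite /= mulrnAr -exprS scaler_nat.
rewrite linearZ/= moment_formXn.
have := laguerre_moment_rec c0 (al1D i).
rewrite -addrA natr1 => E.
rewrite [c * (_ * _)]mulrCA -E -natr1; ring.
Qed.

End laguerre_form.

Theorem mainTheorem6 (R : realType) (r : nat) (alpha : R) (c : 'I_r -> R)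
    (L : multiindex r -> {poly R})
    (hr : (1 <= r)%N) (halpha : -1 < alpha)
    (hc0 : forall j : 'I_r, 0 < c j)
    (hc : forall i j : 'I_r, i != j -> c i != c j)
    (hL : forall n : multiindex r, is_multiple_laguerre2 alpha c n (L n))
    (a b : multiindex r -> 'I_r -> R) :
  nearest_neighbor_recurrence L a b <->
  (forall (n : multiindex r) (j : 'I_r),
     a n j = ((mi_size n)%:R + alpha) * (n j)%:R / c j ^+ 2) /\
  (forall (n : multiindex r) (k : 'I_r),
     b n k = ((mi_size n)%:R + alpha + 1) / c k
             + \sum_(j < r) (n j)%:R / c j).
Proof.
apply: (@nearest_neighbor_recurrence_orth R r alpha c
  (fun j => laguerre_form alpha (c j))).
- by move=> j; rewrite gt_eqF.
- exact: hc.
- by move=> j p; exact: laguerre_form_ibp.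
- by move=> j m; exact: laguerre_form_Xn_neq0.
(* Each integral condition in [hL] says that [laguerre_form] vanishes at ['X^k * L n], which is
   orthogonality with shift 0. *)
move=> n; have [mL sL oL] := hL n; split=> // j k kn; rewrite add0n.
have := oL j k kn.
under eq_integral do rewrite -hornerXn -hornerM.
by rewrite laguerre_form_integral// => -[].
Qed.
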